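(* Let $\mathcal{H}_{Q,\kappa}$ be a quantum Drinfeld Hecke algebra. Then (1) the parameter $\kappa$ is a quantum $2$-form; (2) the matrix $Q$ is a quantum system of parameters; and (3) the group $G$ acts upon the quantum polynomial algebra $S_Q(V)$ by automorphisms.
   Context: Let $\mathbb{K}$ be a field of arbitrary characteristic, $V$ a finite-dimensional $\mathbb{K}$-vector space with fixed basis $v_1,\dots,v_n$, and $G\subset \mathrm{GL}(V)$ a finite group. Let $\{t_g: g\in G\}$ be the standard basis of the group algebra $\mathbb{K}G$; the identity of $G$ and the corresponding $t_e$ are identified with $1\in\mathbb{K}$. Let $Q=(q_{ij}: 1\le i,j\le n)$ be a collection of arbitrary nonzero scalars in $\mathbb{K}$ and let $\kappa(v_i,v_j)=\sum_{g\in G}\kappa_g(v_i,v_j)t_g\in\mathbb{K}G$ (with $\kappa_g(v_i,v_j)\in\mathbb{K}$) for $1\le i,j\le n$ be arbitrary. The associative $\mathbb{K}$-algebra $\mathcal{H}_{Q,\kappa}$ is generated by $\{v_1,\dots,v_n\}\cup\{t_g: g\in G\}$ subject to the relations: (a) $t_gt_h=t_{gh}$ for all $g,h\in G$; (b) $t_g v=g(v)t_g$ for all $g\in G$, $v\in V$; (c) $v_jv_i=q_{ij}v_iv_j+\kappa(v_i,v_j)$ for $1\le i,j\le n$. It is called a quantum Drinfeld Hecke algebra if $\{v_1^{\alpha_1}\cdots v_n^{\alpha_n}t_g: \alpha_i\in\mathbb{N}, g\in G\}$ (with $0\in\mathbb{N}$) is a $\mathbb{K}$-basis of $\mathcal{H}_{Q,\kappa}$.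 $Q$ is a quantum system of parameters if $q_{ii}=1$ and $q_{ij}=q_{ji}^{-1}$ for all $i,j$. $\kappa$ is a quantum $2$-form if $\kappa(v_i,v_i)=0$ and $\kappa(v_j,v_i)=-q_{ij}^{-1}\kappa(v_i,v_j)$ for all $i\neq j$. The quantum polynomial algebra is $S_Q(V)=\mathbb{K}\langle v_1,\dots,v_n\rangle/\langle v_jv_i-q_{ij}v_iv_j: 1\le i<j\le n\rangle$. ''$G$ acts on $S_Q(V)$ by automorphisms'' means that the linear action of each $g\in G$ on $V$ extends to an algebra automorphism of $S_Q(V)$. *)

(* Defs.v *)
(* MathComp. Quotients by undecidable ideals use the classical boolp; the free
   algebra on X is the monoid algebra of the free monoid {fmonom X}. *)
From HB Require Import structures.
From mathcomp Require Import all_fingroup all_boot all_algebra.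
From mathcomp Require Import boolp.
From mathcomp Require Import monalg.

Set Implicit Arguments.
Unset Strict Implicit.
Unset Printing Implicit Defensive.

Import GRing.Theory.

Local Open Scope ring_scope.
Local Open Scope quotient_scope.

Definition two_sided_ideal (A : pzRingType) (J : A -> Prop) : Prop :=
  [/\ J 0,
      forall x y, J x -> J y -> J (x + y),
      forall a x, J x -> J (a * x)
    & forall a x, J x -> J (x * a)].

Definition ideal_generated (A : pzRingType) (r : A -> Prop) (x : A) : Prop :=
  forall J : A -> Prop, two_sided_ideal J -> (forall y, r y -> J y) -> J x.

Section QuotientAlgebra.
Context (K : fieldType) (A : lalgType K) (r : A -> Prop).

Lemma ideal_generatedP : two_sided_ideal (ideal_generated r).
Proof.
split=> [J [] //|x y Jx Jy J idJ rJ|a x Jx J idJ rJ|a x Jx J idJ rJ];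
  case: (idJ) => _ JD Jl Jr.
- by apply: JD; [apply: Jx | apply: Jy].
- by apply: Jl; apply: Jx.
- by apply: Jr; apply: Jx.
Qed.

Definition ideal_pred : {pred A} := fun x => `[< ideal_generated r x >].

Fact ideal_pred_zmod_closed : zmod_closed ideal_pred.
Proof.
case: ideal_generatedP => J0 JD Jl Jr; split; first exact/asboolP.
move=> x y /asboolP Jx /asboolP Jy; apply/asboolP.
by apply: JD => //; rewrite -mulN1r; apply: Jl.
Qed.

HB.instance Definition _ :=
  GRing.isZmodClosed.Build A ideal_pred ideal_pred_zmod_closed.

Fact ideal_predMl a x : x \in ideal_pred -> a * x \in ideal_pred.
Proof.
by case: ideal_generatedP => _ _ Jl _ /asboolP Jx; apply/asboolP; apply: Jl.
Qed.

Fact ideal_predMr a x : x \in ideal_pred -> x * a \in ideal_pred.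
Proof.
by case: ideal_generatedP => _ _ _ Jr /asboolP Jx; apply/asboolP; apply: Jr.
Qed.

Definition quot_alg : Type := Quotient.quot ideal_pred.

HB.instance Definition _ := GRing.Zmodule.on quot_alg.
HB.instance Definition _ := ZmodQuotient.on quot_alg.

Definition quot_pi (x : A) : quot_alg := \pi_quot_alg x.

Lemma quot_piP x y : reflect (quot_pi x = quot_pi y) (x - y \in ideal_pred).
Proof. by rewrite Quotient.idealrBE; apply: eqP. Qed.

Fact quot_pi_zmod_morphism : zmod_morphism quot_pi.
Proof. by move=> x y; rewrite /quot_pi !piE. Qed.

HB.instance Definition _ :=
  GRing.isZmodMorphism.Build A quot_alg quot_pi quot_pi_zmod_morphism.

Definition quot_mul (x y : quot_alg) : quot_alg := quot_pi (repr x * repr y).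
Definition quot_scale (c : K) (x : quot_alg) : quot_alg :=
  quot_pi (c *: repr x).

Lemma quot_repr x : repr (quot_pi x) - x \in ideal_pred.
Proof. by apply/quot_piP; rewrite /quot_pi reprK. Qed.

Lemma quot_piM x y : quot_pi (x * y) = quot_mul (quot_pi x) (quot_pi y).
Proof.
apply/esym/quot_piP; set x' := repr _; set y' := repr _.
have ->: x' * y' - x * y = (x' - x) * y' + x * (y' - y).
  by rewrite mulrBl mulrBr addrA subrK.
by apply: rpredD; [apply/ideal_predMr/quot_repr | apply/ideal_predMl/quot_repr].
Qed.

Lemma quot_piZ c x : quot_pi (c *: x) = quot_scale c (quot_pi x).
Proof.
apply/esym/quot_piP; rewrite -scalerBr -mulr_algl.
by rewrite ideal_predMl // quot_repr.
Qed.

Lemma quot_ind (P : quot_alg -> Prop) :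
  (forall x, P (quot_pi x)) -> forall x, P x.
Proof. by move=> Ppi x; rewrite -[x]reprK; apply: Ppi. Qed.

Fact quot_mulA : associative quot_mul.
Proof.
elim/quot_ind=> x; elim/quot_ind=> y; elim/quot_ind=> z.
by rewrite -!quot_piM mulrA.
Qed.

Fact quot_mul1 : left_id (quot_pi 1) quot_mul.
Proof. by elim/quot_ind=> x; rewrite -quot_piM mul1r. Qed.

Fact quot_mulr1 : right_id (quot_pi 1) quot_mul.
Proof. by elim/quot_ind=> x; rewrite -quot_piM mulr1. Qed.

Fact quot_mulDl : left_distributive quot_mul +%R.
Proof.
elim/quot_ind=> x; elim/quot_ind=> y; elim/quot_ind=> z.
by rewrite -raddfD -!quot_piM mulrDl raddfD.
Qed.

Fact quot_mulDr : right_distributive quot_mul +%R.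
Proof.
elim/quot_ind=> x; elim/quot_ind=> y; elim/quot_ind=> z.
by rewrite -raddfD -!quot_piM mulrDr raddfD.
Qed.

(* The quotient may collapse to 0, hence only a pzRingType. *)
HB.instance Definition _ := GRing.Zmodule_isPzRing.Build quot_alg
  quot_mulA quot_mul1 quot_mulr1 quot_mulDl quot_mulDr.

Fact quot_scaleA a b x :
  quot_scale a (quot_scale b x) = quot_scale (a * b) x.
Proof. by elim/quot_ind: x => x; rewrite -!quot_piZ scalerA. Qed.

Fact quot_scale1 : left_id 1 quot_scale.
Proof. by elim/quot_ind=> x; rewrite -quot_piZ scale1r. Qed.

Fact quot_scaleDr : right_distributive quot_scale +%R.
Proof.
move=> c; elim/quot_ind=> x; elim/quot_ind=> y.
by rewrite -raddfD -!quot_piZ scalerDr raddfD.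
Qed.

Fact quot_scaleDl x : {morph quot_scale^~ x : a b / a + b}.
Proof.
by elim/quot_ind: x => x a b; rewrite -!quot_piZ scalerDl raddfD.
Qed.

HB.instance Definition _ := GRing.Zmodule_isLmodule.Build K quot_alg
  quot_scaleA quot_scale1 quot_scaleDr quot_scaleDl.

Fact quot_pi_monoid_morphism : monoid_morphism quot_pi.
Proof. by split=> // x y; exact: quot_piM. Qed.

HB.instance Definition _ :=
  GRing.isMonoidMorphism.Build A quot_alg quot_pi quot_pi_monoid_morphism.

Fact quot_pi_scalable : scalable quot_pi.
Proof. by move=> c x; exact: quot_piZ. Qed.

HB.instance Definition _ :=
  GRing.isScalable.Build K A quot_alg *:%R quot_pi quot_pi_scalable.

End QuotientAlgebra.

Definition free_alg (K : fieldType) (X : choiceType) : lalgType K :=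
  {malg K[{fmonom X}]}.

Definition free_gen (K : fieldType) (X : choiceType) (x : X) : free_alg K X :=
  << fmu x >>.
Arguments free_gen K {X} x.

(* A basis as an indexed family: the members are in particular distinct. *)
Definition is_basis (K : fieldType) (L : lmodType K) (I : choiceType)
    (b : I -> L) : Prop :=
  (forall x : L, exists (s : seq I) (c : I -> K),
      x = \sum_(i <- s) c i *: b i) /\
  (forall (s : seq I) (c : I -> K), uniq s ->
      \sum_(i <- s) c i *: b i = 0 -> {in s, forall i, c i = 0}).

(* The inclusion of a finite group G into GL(V): a faithful linear action. *)
Definition finite_linear_group (K : fieldType) (V : vectType K)
    (gT : finGroupType) (act : gT -> 'End(V)) : Prop :=
  [/\ act 1%g = \1%VF,
      forall g h, act (g * h)%g = (act g \o act h)%VF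
    & injective act].

Definition lin_ext (K : fieldType) (V : vectType K) (n : nat)
    (v : n.-tuple V) (L : lmodType K) (x : 'I_n -> L) (u : V) : L :=
  \sum_(i < n) coord v i u *: x i.

Definition quantum_system (K : fieldType) (n : nat) (Q : 'M[K]_n) : Prop :=
  (forall i, Q i i = 1) /\ (forall i j, Q i j = (Q j i)^-1).

(* The group algebra KG is {ffun gT -> K^o}; f g is the coefficient of t_g. *)
Definition quantum_2form (K : fieldType) (n : nat) (gT : finGroupType)
    (Q : 'M[K]_n) (kappa : 'I_n -> 'I_n -> {ffun gT -> K^o}) : Prop :=
  (forall i, kappa i i = 0) /\
  (forall i j, i != j -> kappa j i = - ((Q i j)^-1 *: kappa i j)).

Section QuantumPolynomials.
Context (K : fieldType) (n : nat) (Q : 'M[K]_n).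

Local Notation x := (free_gen K : 'I_n -> free_alg K 'I_n).

Inductive qpoly_rel : free_alg K 'I_n -> Prop :=
| QPolyRel (i j : 'I_n) of (i < j)%N :
    qpoly_rel (x j * x i - Q i j *: (x i * x j)).

Definition qpoly_gen (i : 'I_n) : quot_alg qpoly_rel := quot_pi qpoly_rel (x i).

End QuantumPolynomials.

Notation qpoly Q := (quot_alg (qpoly_rel Q)).

Definition alg_automorphism (K : fieldType) (n : nat) (Q : 'M[K]_n)
    (f : qpoly Q -> qpoly Q) : Prop :=
  [/\ linear f, monoid_morphism f & bijective f].

Definition acts_by_automorphisms (K : fieldType) (V : vectType K) (n : nat)
    (v : n.-tuple V) (gT : finGroupType) (act : gT -> 'End(V))
    (Q : 'M[K]_n) : Prop :=
  forall g : gT, exists2 f : qpoly Q -> qpoly Q, alg_automorphism f &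
    forall u : V,
      f (lin_ext v (qpoly_gen Q) u) = lin_ext v (qpoly_gen Q) (act g u).

Section QuantumDrinfeldHecke.
Context (K : fieldType) (V : vectType K) (n : nat) (v : n.-tuple V).
Context (gT : finGroupType) (act : gT -> 'End(V)).
Context (Q : 'M[K]_n) (kappa : 'I_n -> 'I_n -> {ffun gT -> K^o}).

Local Notation F := (free_alg K ('I_n + gT)%type).
Local Notation x := (fun i : 'I_n => free_gen K (inl i) : F).
Local Notation t := (fun g : gT => free_gen K (inr g) : F).

Inductive qdh_rel : F -> Prop :=
| QDHRelOne : qdh_rel (t 1%g - 1)
| QDHRelGroup (g h : gT) : qdh_rel (t g * t h - t (g * h)%g)
| QDHRelAct (g : gT) (u : V) :
    qdh_rel (t g * lin_ext v x u - lin_ext v x (act g u) * t g)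
| QDHRelComm (i j : 'I_n) :
    qdh_rel (x j * x i -
      (Q i j *: (x i * x j) + \sum_g (kappa i j g : K) *: t g)).

Local Notation qdh := (quot_alg qdh_rel).

Definition qdh_v (i : 'I_n) : qdh := quot_pi qdh_rel (x i).
Definition qdh_t (g : gT) : qdh := quot_pi qdh_rel (t g).

(* The product over 'I_n is taken in increasing order of the index. *)
Definition pbw_monomial (m : {ffun 'I_n -> nat} * gT) : qdh :=
  (\prod_(i < n) qdh_v i ^+ m.1 i) * qdh_t m.2.

Definition is_quantum_Drinfeld_Hecke : Prop := is_basis pbw_monomial.

End QuantumDrinfeldHecke.

(* Main.v *)
(* By the PBW basis property, a quadratic form sum_(k,l) a_kl v_k v_l in H lying
   in the group algebra satisfies a_kk = 0 and a_kl + q_kl a_lk = 0 for k < l: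
   these are the coefficients of the basis monomials v_k v_l (k <= l) once the
   products v_l v_k with k < l have been reordered.  Parts (1) and (2) follow
   from relation (c) taken in both orders.  For part (3), conjugating
   v_j v_i - q_ij v_i v_j by t_g puts g(v_j) g(v_i) - q_ij g(v_i) g(v_j) in the
   group algebra; the resulting equations on coefficients are exactly those that
   make the same expression vanish in S_Q(V), so g extends to S_Q(V), with
   inverse the extension of g^-1. *)

Require Import Defs.
From HB Require Import structures.
From mathcomp Require Import all_fingroup all_boot all_algebra.
From mathcomp Require Import boolp monalg.

Set Implicit Arguments.
Unset Strict Implicit.
Unset Printing Implicit Defensive.

Import GRing.Theory.

Local Open Scope ring_scope.

(** * Universal property of the free algebra *)

Section FreeAlgebra.
Context (K : fieldType).

Lemma malgC_comm (X : choiceType) (c : K) (p : {malg K[{fmonom X}]}) :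
  GRing.comm c%:MP p.
Proof.
rewrite /GRing.comm [RHS](fgmulgU c _ p) [LHS](fgmulUg c _ p).
by apply: eq_bigr => m _; rewrite mulrC mul1m mulm1.
Qed.

(** An [lalgType] only moves scalars through the left factor; the right factor follows from the
    centrality of constants. *)
Lemma free_alg_scalerAr (X : choiceType) (c : K) (p q : free_alg K X) :
  c *: (p * q) = p * (c *: q).
Proof.
rewrite -[c *: (p * q)]mul_malgC -[c *: q]mul_malgC mulrA.
by rewrite [_%:MP * p]malgC_comm mulrA.
Qed.

(* The target is a free algebra, not an arbitrary one, because [mmap] requires a
   nonzero ring, which a quotient by relations need not be. *)
Section Substitution.
Context (X Y : choiceType) (y : X -> free_alg K Y).

Definition monom_subst (m : {fmonom X}) : {malg K[{fmonom Y}]} :=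
  \prod_(i <- m) (y i : {malg K[{fmonom Y}]}).

Fact monom_subst_mmorphism : mmorphism monom_subst.
Proof.
by split=> [m1 m2|]; rewrite /monom_subst ?fmM ?big_cat ?fm1 ?big_nil.
Qed.

HB.instance Definition _ :=
  isMultiplicative.Build {fmonom X} {malg K[{fmonom Y}]} monom_subst
    monom_subst_mmorphism.

Definition free_subst (p : free_alg K X) : free_alg K Y :=
  mmap malgC monom_subst p.

Fact free_subst_zmod_morphism : zmod_morphism free_subst.
Proof. exact: mmap_is_additive. Qed.

HB.instance Definition _ := GRing.isZmodMorphism.Build
  (free_alg K X) (free_alg K Y) free_subst free_subst_zmod_morphism.

Fact free_subst_monoid_morphism : monoid_morphism free_subst.
Proof.
have [M1 M2] : multiplicative (mmap malgC monom_subst).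
  by apply: commr_mmap_is_multiplicative => g m m'; apply: malgC_comm.
by split; [exact: M2 | exact: M1].
Qed.

HB.instance Definition _ := GRing.isMonoidMorphism.Build
  (free_alg K X) (free_alg K Y) free_subst free_subst_monoid_morphism.

Fact free_subst_scalable : scalable free_subst.
Proof.
move=> c p; rewrite -[c *: free_subst p]mul_malgC.
exact: (mmapZ (f := malgC)).
Qed.

HB.instance Definition _ := GRing.isScalable.Build
  K (free_alg K X) (free_alg K Y) *:%R free_subst free_subst_scalable.

Lemma free_subst_gen i : free_subst (free_gen K i) = y i.
Proof.
rewrite /free_subst /free_gen (mmapU (f := malgC)).
by rewrite /monom_subst fmU big_seq1 mul_malgC scale1r.
Qed.

End Substitution.

Lemma malgU_gen (X : choiceType) (m : {fmonom X}) (c : K) :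
  << c *g m >> = c *: \prod_(i <- m) free_gen K i :> free_alg K X.
Proof.
have -> : << c *g m >> = c *: << m >> :> {malg K[{fmonom X}]}.
  by apply/malgP => k; rewrite mcoeffZ [LHS]mcoeffU [in RHS]mcoeffU mulrnAr mulr1.
congr (_ *: _); case: m => s; elim: s => [|i s IH].
  by rewrite big_nil -fmoneE.
rewrite big_cons -IH; apply/esym; apply: etrans (fgmulUU _ _ _ _) _.
by rewrite mulr1 [mmul _ _]fmmulE fmuE.
Qed.

Lemma free_alg_eq_morph (X Y : choiceType)
    (f g : {lrmorphism free_alg K X -> free_alg K Y}) :
  (forall i, f (free_gen K i) = g (free_gen K i)) -> f =1 g.
Proof.
move=> fg p; rewrite [p]monalgE.
rewrite [LHS](raddf_sum f) [RHS](raddf_sum g).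
apply: eq_bigr => m _; rewrite malgU_gen [LHS]linearZ [RHS]linearZ /=.
congr (_ *: _); rewrite [LHS]rmorph_prod [RHS]rmorph_prod.
by apply: eq_bigr => i _; apply: fg.
Qed.

End FreeAlgebra.

(** * Descent of endomorphisms to a quotient *)

Section QuotientMorphism.
Context (K : fieldType) (A : lalgType K) (r : A -> Prop).

Lemma quot_pi_rel a b : r (a - b) -> quot_pi r a = quot_pi r b.
Proof. by move=> rab; apply/quot_piP/asboolP => J _; apply. Qed.

Lemma quot_pi_scale c a : quot_pi r (c *: a) = c *: quot_pi r a.
Proof. exact: linearZ. Qed.

(** Computed on a chosen representative, hence defined for any function [phi]; the choice becomes
    immaterial once [phi] is a morphism that respects the relations. *)
Definition quot_map (phi : A -> A) (z : quot_alg r) : quot_alg r :=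
  quot_pi r (phi (repr z)).

Context (phi : {lrmorphism A -> A}).
Hypothesis phi_rel : forall a, r a -> quot_pi r (phi a) = 0.

Lemma quot_map_pi a : quot_map phi (quot_pi r a) = quot_pi r (phi a).
Proof.
apply/eqP; rewrite -subr_eq0 -!raddfB.
have /asboolP := @quot_repr _ _ r a; move: (_ - a) => b rb; apply/eqP.
(* The kernel of the composite of [phi] with the projection is a two-sided ideal containing the
   relations, so it contains [b]. *)
apply: (rb (fun b => quot_pi r (phi b) = 0)) => //; split => [|c d|c d|c d].
- by rewrite !raddf0.
- by move=> Jc Jd; rewrite [phi _]raddfD [LHS]raddfD /= Jc Jd addr0.
- by move=> Jd; rewrite [phi _]rmorphM [LHS]rmorphM /= Jd mulr0.
- by move=> Jd; rewrite [phi _]rmorphM [LHS]rmorphM /= Jd mul0r.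
Qed.

Lemma quot_map_linear : linear (quot_map phi).
Proof.
move=> c; elim/quot_ind=> a; elim/quot_ind=> b.
by rewrite -linearP !quot_map_pi !linearP.
Qed.

Lemma quot_map_monoid_morphism : monoid_morphism (quot_map phi).
Proof.
split; first by rewrite -[1](rmorph1 (quot_pi r)) quot_map_pi !rmorph1.
elim/quot_ind=> a; elim/quot_ind=> b.
by rewrite -rmorphM !quot_map_pi !rmorphM.
Qed.

End QuotientMorphism.

(** * Sums over pairs, ordered products and finite free families *)

Section SquareSums.
Context (n : nat) (M : nmodType).

Lemma sum_square (f : 'I_n -> 'I_n -> M) :
  \sum_i \sum_j f i j =
    \sum_i f i i + \sum_(p : 'I_n * 'I_n | (p.1 < p.2)%N) (f p.1 p.2 + f p.2 p.1).
Proof.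
rewrite pair_big /= (bigID (fun p => p.1 == p.2)) /=; congr (_ + _).
  rewrite -(pair_big_dep xpredT (fun i j => i == j)) /=.
  by apply: eq_bigr => i _; rewrite (big_pred1 i) // => j; rewrite eq_sym.
rewrite (bigID (fun p : 'I_n * 'I_n => (p.1 < p.2)%N)) big_split /=; congr (_ + _).
  by apply: eq_bigl => -[i j] /=; rewrite -val_eqE /= neq_ltn; case: ltngtP.
have swapK : cancel (@swap_pair 'I_n 'I_n) swap_pair by case.
rewrite (reindex_inj (can_inj swapK)) /=.
by apply: eq_bigl => -[i j] /=; rewrite -val_eqE /= neq_ltn; case: ltngtP.
Qed.

End SquareSums.

Lemma prod_ord_pair (R : pzSemiRingType) (n : nat) (x : 'I_n -> R) (k l : 'I_n) :
  (k <= l)%N -> \prod_(i < n) x i ^+ ((i == k) + (i == l)) = x k * x l.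
Proof.
move=> le_kl; have [<-|neq_kl] := eqVneq k l.
  rewrite -expr2 -[RHS](big_pred1_eq *%R k (fun i => x i ^+ 2)) [RHS]big_mkcond /=.
  by apply: eq_bigr => i _; case: eqP.
have lt_kl : (k < l)%N by rewrite ltn_neqAle le_kl andbT.
transitivity (\prod_(i <- [:: k; l]) x i); last by rewrite big_cons big_seq1.
(* [R] need not be commutative, so the order of the factors matters: both lists are strictly
   increasing with the same members, hence equal. *)
have -> : [:: k; l] = filter (pred2 k l) (index_enum 'I_n).
  apply: (@irr_sorted_eq _ (fun i j : 'I_n => (i < j)%N)) => /=.
  - by move=> ? ? ?; apply: ltn_trans.
  - by move=> ?; rewrite /= ltnn.
  - by rewrite lt_kl.
  - apply: sorted_filter; first by move=> ? ? ?; apply: ltn_trans.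
    rewrite [index_enum _]unlock -enumT.
    by rewrite -(@sorted_map _ _ val ltn) val_enum_ord iota_ltn_sorted.
  - by move=> i; rewrite mem_filter mem_index_enum andbT !inE.
rewrite big_filter [RHS]big_mkcond /=; apply: eq_bigr => i _.
have [->|] := eqVneq i k; first by rewrite (negPf neq_kl).
by case: (i == l).
Qed.

(** Adapts the freeness in [is_basis], stated for duplicate-free sequences of basis indices, to
    families reindexed by a finite type. *)
Lemma is_basis_free (K : fieldType) (L : lmodType K) (I : choiceType) (b : I -> L)
    (J : finType) (P : pred J) (h : J -> I) (c : J -> K) :
  is_basis b -> {in P &, injective h} ->
  \sum_(j | P j) c j *: b (h j) = 0 -> forall j, P j -> c j = 0.
Proof.
case=> _ b_free h_inj sum0 j0 Pj0.
pose s := [seq h j | j <- enum P].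
(* Push-forward of [c] along [h]; injectivity on [P] leaves a single term at each [h j]. *)
pose d i := \sum_(j | P j && (h j == i)) c j.
have dh j : P j -> d (h j) = c j.
  move=> Pj; rewrite /d (big_pred1 j) // => j' /=.
  by apply/andP/eqP => [[Pj' /eqP/h_inj->]|->].
have s_uniq : uniq s.
  by rewrite map_inj_in_uniq ?enum_uniq // => i j; rewrite !mem_enum; apply: h_inj.
rewrite -(dh _ Pj0); apply: (b_free s d s_uniq); last first.
  by apply: map_f; rewrite mem_enum.
rewrite big_map -[RHS]sum0 big_enum; apply: eq_bigr => j Pj.
by rewrite dh.
Qed.

Lemma intertwineM (R : pzSemiRingType) (t a b a' b' : R) :
  t * a = a' * t -> t * b = b' * t -> t * (a * b) = a' * b' * t.
Proof. by move=> ta tb; rewrite mulrA ta -mulrA tb mulrA. Qed.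

(** * Linear combinations of generators and their q-commutators *)

Section LinExt.
Context (K : fieldType) (V : vectType K) (n : nat) (v : n.-tuple V).

Lemma lin_ext_quot (A : lalgType K) (r : A -> Prop) (x : 'I_n -> A) u :
  quot_pi r (lin_ext v x u) = lin_ext v (fun i => quot_pi r (x i)) u.
Proof.
by rewrite /lin_ext raddf_sum; apply: eq_bigr => i _ /=; rewrite quot_pi_scale.
Qed.

(** Coefficient of [y k * y l] in the q-commutator of the images of [u] and [w], before any
    reordering; it is the same for every choice of generators [y]. *)
Definition qcomm_coef (q : K) (u w : V) (k l : 'I_n) : K :=
  coord v k u * coord v l w - q * (coord v k w * coord v l u).

Section Quotient.
Context (X : choiceType) (r : free_alg K X -> Prop).
Implicit Types (y : 'I_n -> quot_alg r).

(** The quotient receives its ring and module structures separately; their compatibility is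
    inherited through the projection. *)
Lemma quot_scalerAl c (x y : quot_alg r) : c *: (x * y) = c *: x * y.
Proof.
elim/quot_ind: x => x; elim/quot_ind: y => y.
by rewrite -quot_pi_scale -!rmorphM -quot_pi_scale scalerAl.
Qed.

Lemma quot_scalerAr c (x y : quot_alg r) : c *: (x * y) = x * (c *: y).
Proof.
elim/quot_ind: x => x; elim/quot_ind: y => y.
by rewrite -quot_pi_scale -!rmorphM -quot_pi_scale free_alg_scalerAr.
Qed.

Lemma quot_qcomm_conj (q : K) (t a b a' b' : quot_alg r) :
  t * a = a' * t -> t * b = b' * t ->
  t * (a * b - q *: (b * a)) = (a' * b' - q *: (b' * a')) * t.
Proof.
move=> ta tb; rewrite mulrBr mulrBl -quot_scalerAr -quot_scalerAl.
exact: (congr2 (fun y z : quot_alg r => y - q *: z)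
  (intertwineM ta tb) (intertwineM tb ta)).
Qed.

Lemma lin_ext_mul y u w :
  lin_ext v y u * lin_ext v y w =
  \sum_k \sum_l (coord v k u * coord v l w) *: (y k * y l).
Proof.
rewrite /lin_ext mulr_suml; apply: eq_bigr => k _.
rewrite mulr_sumr; apply: eq_bigr => l _.
by rewrite -quot_scalerAl -quot_scalerAr scalerA.
Qed.

Lemma lin_ext_qcomm y q u w :
  lin_ext v y u * lin_ext v y w - q *: (lin_ext v y w * lin_ext v y u) =
  \sum_k \sum_l qcomm_coef q u w k l *: (y k * y l).
Proof.
(* Here and below, [congr2] replaces rewriting, whose unification would unfold the
   multiplication of the quotient and not return. *)
apply: etrans (congr2 (fun a b => a - q *: b) (lin_ext_mul y u w) _) _.
  exact: lin_ext_mul.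
rewrite [q *: _]scaler_sumr -[LHS]sumrB; apply: eq_bigr => k _.
rewrite [q *: _]scaler_sumr -[LHS]sumrB; apply: eq_bigr => l _.
by rewrite scalerA -scalerBl.
Qed.

End Quotient.

Lemma lin_ext_linear (L : lmodType K) (x : 'I_n -> L) : linear (lin_ext v x).
Proof.
move=> c u w; rewrite /lin_ext scaler_sumr -big_split /=.
by apply: eq_bigr => i _; rewrite linearP scalerDl scalerA.
Qed.

HB.instance Definition _ (L : lmodType K) (x : 'I_n -> L) :=
  GRing.isLinear.Build K V L *:%R (lin_ext v x) (lin_ext_linear x).

Hypothesis v_basis : basis_of fullv v.

Lemma coord_basis_delta (i j : 'I_n) : coord v i v`_j = (i == j)%:R.
Proof. by rewrite coord_free ?(basis_free v_basis) // eq_sym. Qed.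

Lemma lin_ext_basis (L : lmodType K) (x : 'I_n -> L) (i : 'I_n) :
  lin_ext v x v`_i = x i.
Proof.
rewrite /lin_ext (bigD1 i) //= coord_basis_delta eqxx scale1r big1 ?addr0 // => j ji.
by rewrite coord_basis_delta (negPf ji) scale0r.
Qed.

End LinExt.

(** * Comparison of PBW coefficients and the constraints on [Q] and [kappa] *)

Section QDHTheory.
Context (K : fieldType) (V : vectType K) (n : nat) (v : n.-tuple V).
Context (gT : finGroupType) (act : gT -> 'End(V)).
Context (Q : 'M[K]_n) (kappa : 'I_n -> 'I_n -> {ffun gT -> K^o}).

Local Notation rel := (qdh_rel v act Q kappa).
Local Notation X := (qdh_v v act Q kappa).
Local Notation T := (qdh_t v act Q kappa).
Local Notation L := (lin_ext v X).

Lemma qdh_t1 : T 1%g = 1.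
Proof. by rewrite -(rmorph1 (quot_pi rel)); apply/quot_pi_rel/QDHRelOne. Qed.

Lemma qdh_tM g h : T g * T h = T (g * h)%g.
Proof. by rewrite -rmorphM; apply/quot_pi_rel/QDHRelGroup. Qed.

Lemma qdh_t_act g u : T g * L u = L (act g u) * T g.
Proof. by rewrite -!lin_ext_quot -!rmorphM; apply/quot_pi_rel/QDHRelAct. Qed.

Lemma qdh_comm i j :
  X j * X i = Q i j *: (X i * X j) + \sum_g (kappa i j g : K) *: T g.
Proof.
rewrite -!rmorphM -quot_pi_scale.
have -> : \sum_g (kappa i j g : K) *: T g =
    quot_pi rel (\sum_g (kappa i j g : K) *: free_gen K (inr g)).
  by rewrite raddf_sum; apply: eq_bigr => g _ /=; rewrite quot_pi_scale.
by rewrite -raddfD; apply/quot_pi_rel/QDHRelComm.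
Qed.

Lemma pbw_monomial2 (k l : 'I_n) : (k <= l)%N ->
  pbw_monomial v act Q kappa ([ffun i => ((i == k) + (i == l))%N], 1%g) =
  X k * X l.
Proof.
move=> le_kl; rewrite /pbw_monomial /= qdh_t1 mulr1 -prod_ord_pair //.
by apply: eq_bigr => i _; rewrite ffunE.
Qed.

Lemma pbw_monomial0 g : pbw_monomial v act Q kappa ([ffun=> 0%N], g) = T g.
Proof.
by rewrite /pbw_monomial big1 ?mul1r // => i _; rewrite ffunE expr0.
Qed.

Hypothesis H_qdh : is_quantum_Drinfeld_Hecke v act Q kappa.

(** The ordered quadratic monomials and the group elements are pairwise distinct members of the PBW
    basis. Indexing both by one sum type reduces the claim to the injectivity of the map to
    exponents. *)
Lemma qdh_free2 (b : 'I_n -> 'I_n -> K) (c : gT -> K) :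
  \sum_(p : 'I_n * 'I_n | (p.1 <= p.2)%N) b p.1 p.2 *: (X p.1 * X p.2) +
    \sum_g c g *: T g = 0 ->
  (forall k l : 'I_n, (k <= l)%N -> b k l = 0) /\ (forall g, c g = 0).
Proof.
move=> sum0.
pose P (j : 'I_n * 'I_n + gT) := if j is inl p then (p.1 <= p.2)%N else true.
pose h (j : 'I_n * 'I_n + gT) : {ffun 'I_n -> nat} * gT :=
  match j with
  | inl p => ([ffun i => ((i == p.1) + (i == p.2))%N], 1%g)
  | inr g => ([ffun=> 0%N], g)
  end.
pose d (j : 'I_n * 'I_n + gT) := match j with inl p => b p.1 p.2 | inr g => c g end.
have h_inj : {in P &, injective h}.
  move=> [[k l]|g] [[k' l']|g'] //=; rewrite /in_mem /=.
  - move=> le_kl le_kl' [/ffunP e].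
    (* The smallest index with nonzero exponent is the first of the pair. *)
    have min_le (i j i' j' : 'I_n) : (i' <= j')%N ->
        (forall t, (t == i) + (t == j) = (t == i') + (t == j'))%N -> (i' <= i)%N.
      move=> le' /(_ i); rewrite eqxx -!val_eqE /=.
      by case: (ltngtP i i') => // lt; rewrite (ltn_eqF (leq_trans lt le')).
    have ee t : ((t == k) + (t == l) = (t == k') + (t == l'))%N.
      by have := e t; rewrite !ffunE.
    have kk' : k = k'.
      apply/val_inj/eqP; rewrite eqn_leq (min_le k' l' k l) //=.
      exact: (min_le k l k' l').
    (* At index [l] the contributions of the common first entry cancel, which leaves [l = l']. *)
    have := ee l; rewrite -kk' eqxx => /addnI.
    by rewrite kk'; case: eqP => // ->.
  - by move=> _ _ [/ffunP/(_ k)]; rewrite !ffunE eqxx.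
  - by move=> _ _ [/ffunP/(_ k')]; rewrite !ffunE eqxx.
  - by move=> _ _ [->].
have d0 : forall j, P j -> d j = 0.
  apply: (is_basis_free H_qdh h_inj).
  rewrite big_sumType /=; apply: etrans sum0; apply: (congr2 +%R).
    by apply: eq_bigr => p le_p; rewrite pbw_monomial2.
  by apply: eq_bigr => g _; rewrite pbw_monomial0.
by split=> [k l le_kl|g]; [apply: (d0 (inl (k, l))) | apply: (d0 (inr g))].
Qed.

Lemma qdh_t_free (c : gT -> K) : \sum_g c g *: T g = 0 -> forall g, c g = 0.
Proof.
move=> c0; apply: (proj2 (qdh_free2 (b := fun _ _ => 0) (c := c) _)).
by rewrite c0 addr0 big1 // => p _; rewrite scale0r.
Qed.

Lemma qdh_quadratic (a : 'I_n -> 'I_n -> K) (c : gT -> K) :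
  \sum_k \sum_l a k l *: (X k * X l) = \sum_g c g *: T g ->
  (forall k, a k k = 0) /\
  (forall k l : 'I_n, (k < l)%N -> a k l + Q k l * a l k = 0).
Proof.
move=> ac.
(* [b] and the group coefficients below are those of the left side minus the right side after
   reordering: for [k < l], relation (c) replaces [X l * X k] at the cost of a multiple [a l k] of
   [kappa k l]. *)
pose b k l := if k == l then a k k else a k l + Q k l * a l k.
have [|b0 _] := qdh_free2 (b := b)
  (c := fun g => \sum_(p : 'I_n * 'I_n | (p.1 < p.2)%N)
     a p.2 p.1 * (kappa p.1 p.2 g : K) - c g); last first.
  split=> [k|k l lt_kl].
    by have := b0 k k (leqnn k); rewrite /b eqxx.
  have := b0 k l (ltnW lt_kl); rewrite /b -val_eqE /=.
  by rewrite ltn_eqF.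
have -> : \sum_(p : 'I_n * 'I_n | (p.1 <= p.2)%N) b p.1 p.2 *: (X p.1 * X p.2) =
  \sum_k a k k *: (X k * X k) + \sum_(p : 'I_n * 'I_n | (p.1 < p.2)%N)
     (a p.1 p.2 + Q p.1 p.2 * a p.2 p.1) *: (X p.1 * X p.2).
  rewrite [LHS](bigID (fun p : 'I_n * 'I_n => p.1 == p.2)).
  apply: (congr2 +%R) => /=; last first.
    apply: eq_big => [[k l]|[k l] /= /andP[_ /negPf kl]]; last by rewrite /b kl.
    by rewrite /= andbC -ltn_neqAle.
  rewrite (eq_bigl (fun p : 'I_n * 'I_n => p.1 == p.2)); last first.
    by move=> [k l] /=; case: eqP => [->|]; rewrite ?leqnn ?andbF.
  rewrite -(pair_big_dep xpredT (fun i j => i == j)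
     (fun i j => b i j *: (X i * X j))) /=.
  apply: eq_bigr => i _; rewrite (big_pred1 i) => [|j]; last by rewrite eq_sym.
  by rewrite /b eqxx.
move/esym: ac; rewrite sum_square.
under [in X in _ = _ + X]eq_bigr => p _.
  rewrite [X p.2 * X p.1]qdh_comm scalerDr scalerA addrA -scalerDl.
  rewrite [a _ _ * Q _ _]mulrC.
  over.
rewrite big_split /= addrA => ac.
have -> : \sum_g (\sum_(p : 'I_n * 'I_n | (p.1 < p.2)%N)
      a p.2 p.1 * (kappa p.1 p.2 g : K) - c g) *: T g =
    \sum_(p : 'I_n * 'I_n | (p.1 < p.2)%N)
      a p.2 p.1 *: (\sum_g (kappa p.1 p.2 g : K) *: T g) - \sum_g c g *: T g.
  under [X in _ = X - _]eq_bigr do rewrite scaler_sumr.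
  rewrite [X in _ = X - _]exchange_big -[RHS]sumrB.
  apply: eq_bigr => g _; rewrite scalerBl scaler_suml.
  apply: (congr2 +%R); last by [].
  by apply: eq_bigr => p _; rewrite scalerA.
by rewrite addrA -[X in X - _]ac; apply: subrr.
Qed.

(** Applied to basis vectors, this constrains [Q]; applied to their images under [g], it yields the
    equations needed in [S_Q(V)]. *)
Lemma qdh_qcomm_coef q u w (c : gT -> K) :
  L u * L w - q *: (L w * L u) = \sum_g c g *: T g ->
  (forall k, qcomm_coef v q u w k k = 0) /\
  (forall k l : 'I_n, (k < l)%N ->
     qcomm_coef v q u w k l + Q k l * qcomm_coef v q u w l k = 0).
Proof.
move=> Ec; apply: (qdh_quadratic (c := c)); rewrite -Ec.
exact/esym/lin_ext_qcomm.
Qed.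

Hypothesis v_basis : basis_of fullv v.

Lemma qdh_qcomm_gen (i j : 'I_n) :
  L v`_j * L v`_i - Q i j *: (L v`_i * L v`_j) =
  \sum_g (kappa i j g : K) *: T g.
Proof. by rewrite !lin_ext_basis // qdh_comm addrC addKr. Qed.

(** In relation (c) with [j = i], the square of [v_i] has coefficient [1 - Q i i]. *)
Lemma qdh_Q_diag i : Q i i = 1.
Proof.
have [/(_ i) + _] := qdh_qcomm_coef (qdh_qcomm_gen i i).
rewrite /qcomm_coef !coord_basis_delta // eqxx !mulr1.
by move/eqP; rewrite subr_eq0 => /eqP <-.
Qed.

(** For [j < i] the product [v_j v_i] is already ordered; reordering [v_i v_j] in relation (c) gives
    [v_j v_i] the total coefficient [1 - Q j i * Q i j]. *)
Lemma qdh_Q_inv_lt (i j : 'I_n) : (j < i)%N -> Q j i * Q i j = 1.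
Proof.
move=> ji; have [_ /(_ j i ji)] := qdh_qcomm_coef (qdh_qcomm_gen i j).
have neq_ij : (i == j) = false by rewrite -val_eqE /= gtn_eqF.
rewrite /qcomm_coef !coord_basis_delta // !eqxx [j == i]eq_sym neq_ij.
rewrite !mulr0 !mulr1 subr0 sub0r mulrN => /eqP.
by rewrite subr_eq0 => /eqP <-.
Qed.

Lemma qdh_Q_inv i j : Q j i * Q i j = 1.
Proof.
case: (ltngtP i j) => [ij|ji|/val_inj <-]; first by rewrite mulrC qdh_Q_inv_lt.
  exact: qdh_Q_inv_lt.
by rewrite qdh_Q_diag mulr1.
Qed.

Lemma qdh_quantum_system : quantum_system Q.
Proof.
split=> [|i j]; first exact: qdh_Q_diag.
have Qji_neq0 : Q j i != 0.
  by apply: contra_eq_neq (qdh_Q_inv i j) => ->; rewrite mul0r eq_sym oner_neq0.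
by rewrite -[RHS]mulr1 -(qdh_Q_inv i j) mulKf.
Qed.

Lemma qdh_quantum_2form : quantum_2form Q kappa.
Proof.
split=> [i|i j neq_ij].
  apply/ffunP => g; rewrite ffunE.
  apply: (qdh_t_free (c := fun g => kappa i i g : K)).
  by rewrite -qdh_qcomm_gen qdh_Q_diag scale1r subrr.
(* Add relation (c) for [(i, j)] to [Q i j] times the one for [(j, i)]: the quadratic terms cancel
   because [Q i j * Q j i = 1]. *)
have kE : forall g, (kappa i j g : K) + Q i j * (kappa j i g : K) = 0.
  apply: qdh_t_free.
  under eq_bigr => g _ do rewrite scalerDl -scalerA.
  rewrite big_split /= -[X in _ + X]scaler_sumr.
  apply: etrans (congr2 (fun a b => a + Q i j *: b)
    (esym (qdh_qcomm_gen i j)) (esym (qdh_qcomm_gen j i))) _.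
  rewrite scalerBr scalerA.
  by rewrite [Q i j * _]mulrC qdh_Q_inv scale1r addrA subrK subrr.
have [_ <-] := qdh_quantum_system; apply/ffunP => g; rewrite !ffunE.
have /eqP := kE g; rewrite addr_eq0 => /eqP ->.
by rewrite -[RHS]mulrN opprK mulrA qdh_Q_inv mul1r.
Qed.

Lemma qdh_act_qcomm g (i j : 'I_n) :
  exists c : gT -> K,
  L (act g v`_j) * L (act g v`_i) - Q i j *: (L (act g v`_i) * L (act g v`_j))
  = \sum_h c h *: T h.
Proof.
(* These are the coefficients of the conjugate of [kappa i j] by [T g]. *)
exists (fun h => kappa i j (g^-1 * h * g)%g).
set D := LHS; have <- : D * T g * T g^-1%g = D.
  by rewrite -mulrA qdh_tM mulgV qdh_t1 mulr1.
have -> : D * T g = T g * \sum_h (kappa i j h : K) *: T h.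
  apply: etrans (congr1 (fun z => T g * z) (qdh_qcomm_gen i j)).
  by apply/esym/quot_qcomm_conj; apply: qdh_t_act.
rewrite mulr_sumr mulr_suml (reindex (fun h => g^-1 * h * g)%g) /=; last first.
  exists (fun h => g * h * g^-1)%g => h _.
    by rewrite !mulgA mulgV mul1g mulgK.
  by rewrite !mulgA mulVg mul1g mulgKV.
apply: eq_bigr => h _.
by rewrite -quot_scalerAr -quot_scalerAl !qdh_tM !mulgA mulgV mul1g mulgK.
Qed.

End QDHTheory.

(** * Quadratic relations in [S_Q(V)] and linear substitutions *)

Section QuantumPolynomialAction.
Context (K : fieldType) (n : nat) (Q : 'M[K]_n).

(** Counterpart of [qdh_quadratic] in the opposite direction: in [S_Q(V)] reordering leaves no group
    term, so these equations suffice for the form to vanish. *)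
Lemma qpoly_quadratic (a : 'I_n -> 'I_n -> K) :
  (forall k, a k k = 0) ->
  (forall k l : 'I_n, (k < l)%N -> a k l + Q k l * a l k = 0) ->
  \sum_k \sum_l a k l *: (qpoly_gen Q k * qpoly_gen Q l) = 0.
Proof.
move=> a_diag a_off; rewrite sum_square big1 ?add0r; last first.
  by move=> k _; rewrite a_diag scale0r.
rewrite big1 // => -[k l] /= kl.
have -> : qpoly_gen Q l * qpoly_gen Q k =
    Q k l *: (qpoly_gen Q k * qpoly_gen Q l).
  by rewrite -!rmorphM -quot_pi_scale; apply/quot_pi_rel/QPolyRel.
by rewrite scalerA -scalerDl [a l k * _]mulrC a_off // scale0r.
Qed.

Context (V : vectType K) (v : n.-tuple V) (v_basis : basis_of fullv v).

(** The endomorphism of the tensor algebra of [V] induced by [f], written in the basis [v]. *)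
Definition free_act (f : 'End(V)) : free_alg K 'I_n -> free_alg K 'I_n :=
  free_subst (fun i : 'I_n => lin_ext v (free_gen K) (f v`_i)).

HB.instance Definition _ f := GRing.LRMorphism.on (free_act f).

Lemma quot_free_act (r : free_alg K 'I_n -> Prop) f i :
  quot_pi r (free_act f (free_gen K i)) =
  lin_ext v (fun k => quot_pi r (free_gen K k)) (f v`_i).
Proof. by rewrite /free_act free_subst_gen lin_ext_quot. Qed.

Lemma free_act_lin_ext f u :
  free_act f (lin_ext v (free_gen K) u) = lin_ext v (free_gen K) (f u).
Proof.
rewrite [in RHS](coord_basis v_basis (memvf u)) !linear_sum /=.
apply: eq_bigr => i _.
rewrite [LHS]linearZ [f _]linearZ [RHS]linearZ /=.
by rewrite /free_act free_subst_gen.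
Qed.

Lemma free_act_comp f g : (f \o g = \1)%VF -> cancel (free_act g) (free_act f).
Proof.
move=> fgK; apply: (@free_alg_eq_morph _ _ _ (free_act f \o free_act g) idfun).
move=> i /=; rewrite -(lin_ext_basis v_basis (free_gen K) i).
by rewrite !free_act_lin_ext -comp_lfunE fgK id_lfunE.
Qed.

End QuantumPolynomialAction.

(** * The action of the group on [S_Q(V)] *)

Section Action.
Context (K : fieldType) (V : vectType K) (n : nat) (v : n.-tuple V).
Context (gT : finGroupType) (act : gT -> 'End(V)).
Context (Q : 'M[K]_n) (kappa : 'I_n -> 'I_n -> {ffun gT -> K^o}).
Hypotheses (v_basis : basis_of fullv v) (act_linear : finite_linear_group act).
Hypothesis H_qdh : is_quantum_Drinfeld_Hecke v act Q kappa.

Lemma qdh_free_act_rel g a :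
  qpoly_rel Q a -> quot_pi (qpoly_rel Q) (free_act v (act g) a) = 0.
Proof.
case=> i j _; set pi := quot_pi _.
rewrite [free_act _ _ _]raddfB [LHS]raddfB /= [free_act _ _ (_ *: _)]linearZ /=.
rewrite [X in _ - X]quot_pi_scale.
have piM k l : pi (free_act v (act g) (free_gen K k * free_gen K l)) =
    lin_ext v (qpoly_gen Q) (act g v`_k) * lin_ext v (qpoly_gen Q) (act g v`_l).
  rewrite [free_act _ _ _]rmorphM [LHS]rmorphM.
  exact: (congr2 *%R (quot_free_act _ _ _ _) (quot_free_act _ _ _ _)).
apply: etrans (congr2 (fun y z => y - Q i j *: z) (piM j i) (piM i j)) _.
apply: etrans (lin_ext_qcomm _ _ _ _ _) _.
(* The same coefficients occur in [H] and in [S_Q(V)]: the PBW property gives equations on them in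
   [H], which force the sum to vanish here. *)
have [c Ec] := qdh_act_qcomm act Q kappa v_basis g i j.
by have [] := qdh_qcomm_coef H_qdh Ec; apply: qpoly_quadratic.
Qed.

Lemma qdh_acts_by_automorphisms : acts_by_automorphisms v act Q.
Proof.
case: act_linear => act1 actM _ g.
have map_pi h a : quot_map (free_act v (act h)) (quot_pi (qpoly_rel Q) a) =
    quot_pi (qpoly_rel Q) (free_act v (act h) a).
  exact: (quot_map_pi (qdh_free_act_rel h)).
(* Used for [g] and [g^-1] in both orders, this gives the two cancellations that bijectivity
   requires. *)
have mapK h h' : (h * h')%g = 1%g -> cancel
    (quot_map (r := qpoly_rel Q) (free_act v (act h')))
    (quot_map (r := qpoly_rel Q) (free_act v (act h))).
  move=> hh'; elim/quot_ind => a; rewrite [X in quot_map _ X]map_pi map_pi.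
  by apply: (congr1 (quot_pi _)); apply: free_act_comp; rewrite // -actM hh'.
exists (quot_map (free_act v (act g))); last first.
  move=> u; rewrite -[in LHS]lin_ext_quot map_pi free_act_lin_ext //.
  exact: lin_ext_quot.
split; first exact/quot_map_linear/qdh_free_act_rel.
  exact/quot_map_monoid_morphism/qdh_free_act_rel.
by exists (quot_map (free_act v (act g^-1%g))); apply: mapK; rewrite ?mulVg ?mulgV.
Qed.

End Action.

Theorem proposition3p5 (K : fieldType) (V : vectType K) (n : nat)
    (v : n.-tuple V) (gT : finGroupType) (act : gT -> 'End(V))
    (Q : 'M[K]_n) (kappa : 'I_n -> 'I_n -> {ffun gT -> K^o})
    (v_basis : basis_of fullv v) (G_sub_GL : finite_linear_group act)
    (Q_neq0 : forall i j, Q i j != 0)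
    (H_qdh : is_quantum_Drinfeld_Hecke v act Q kappa) :
  [/\ quantum_2form Q kappa,
      quantum_system Q
    & acts_by_automorphisms v act Q].
Proof.
split; first exact: qdh_quantum_2form H_qdh v_basis.
  exact: qdh_quantum_system H_qdh v_basis.
exact: qdh_acts_by_automorphisms H_qdh.
Qed.
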